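(* (1) For $d=2$, the format $\mathrm{MS}_{\mathrm{TT}_{\mathbf r}}$ is closed if and only if $\mathbf r$ is of either the form $(r_0,\dots,r_{k-1},b_s^k,0,\dots,0)$ or the form $(0,0,\dots,0,r_k,0,\dots,0)$. (2) For $d\ge3$, the format $\mathrm{MS}_{\mathrm{TT}_{\mathbf r}}$ is not closed if $\mathbf r=(r_0,\dots,r_{k-1},r_k,0,\dots,0)$, where the first tensor-train rank $(r_k)_1$ of $r_k$ is strictly less than $b_s^k$ and not all $(r_i)_1$ with $i<k$ are zero.
   Context: $b_s\ge2$ is a fixed integer and $L$ is a positive integer; $d$ is the order of the tensors. For a tensor $A\in\mathbb{R}^{b_s^k\times\dots\times b_s^k}$ ($d$ factors) and an integer $\ell\ge0$, $\mathrm{ext}_\ell(A)\in\mathbb{R}^{b_s^{k+\ell}\times\dots\times b_s^{k+\ell}}$ is defined by $\mathrm{ext}_\ell(A)(i_1,\dots,i_d)=A(\lfloor (i_1-1)/b_s^\ell\rfloor+1,\dots,\lfloor (i_d-1)/b_s^\ell\rfloor+1)$ (each entry is replaced by a constant block of side $b_s^\ell$). A tensor $A$ of order $d$ has tensor-train (TT) rank at most $(\rho_1,\dots,\rho_{d-1})$ if $A(i_1,\dots,i_d)=\sum_{\alpha_1=1}^{\rho_1}\cdots\sum_{\alpha_{d-1}=1}^{\rho_{d-1}}G_1(i_1,\alpha_1)G_2(\alpha_1,i_2,\alpha_2)\cdots G_d(\alpha_{d-1},i_d)$ for some arrays $G_j$. For $d=2$ this means that the matrix $A$ has rank at most $\rho_1$.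 A rank bound $0$ means that the tensor is zero. The multiresolution rank vector is $\mathbf r=(r_0,\dots,r_L)$, where each $r_k=((r_k)_1,\dots,(r_k)_{d-1})$ is a vector of TT ranks (a single integer when $d=2$), and $$\mathrm{MS}_{\mathrm{TT}_{\mathbf r}}=\Big\{\sum_{k=0}^L\mathrm{ext}_{L-k}(T_k):\ T_k\in\mathbb{R}^{b_s^k\times\dots\times b_s^k},\ T_k\text{ has TT rank at most }r_k\Big\}\subseteq\mathbb{R}^{b_s^L\times\dots\times b_s^L}.$$ Closedness is with respect to the usual topology of $\mathbb{R}^{b_s^L\times\dots\times b_s^L}$.
   Formalization: In (1) the ranks are assumed to satisfy r_k ≤ b_s^k (else r = (1, b_s+1) is a counterexample); in (2) (r_k)_1 is assumed positive and each rank vector r_i is either zero or has all components positive, since the claim fails otherwise. *)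

(* Defs.v *)
From mathcomp Require Import all_boot all_order all_algebra.
From mathcomp Require Import all_classical all_reals all_analysis.
Import numFieldNormedType.Exports.

Set Implicit Arguments.
Unset Strict Implicit.
Unset Printing Implicit Defensive.

Import Order.TTheory GRing.Theory Num.Theory.
Local Open Scope ring_scope.
Local Open Scope classical_set_scope.

(* Real tensors of order d with all sides n, indexed from 0.  As there are
   finitely many entries, the topology of entrywise convergence carried by
   {ptws _ -> _} is the usual topology of R^(n x ... x n). *)
Definition tensor (R : realType) (n d : nat) : Type :=
  {ptws {ffun 'I_d -> 'I_n} -> R}.

Lemma coarsen_subproof (b k l N : nat) (e : (k + l)%N = N) (i : 'I_(b ^ N)) :
  (i %/ b ^ l < b ^ k)%N.
Proof.
have := ltn_ord i; rewrite -[in X in (_ < X)%N -> _]e expnD => lt_i.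
have bl_gt0 : (0 < b ^ l)%N.
  by rewrite lt0n; apply: contraTneq lt_i => ->; rewrite muln0 ltn0.
by rewrite ltn_divLR.
Qed.

(* floor ((i - 1) / b^l) + 1 for 1-based indices is i %/ b^l for 0-based ones. *)
Definition coarsen (b k l N : nat) (e : (k + l)%N = N) (i : 'I_(b ^ N)) :
    'I_(b ^ k) :=
  Ordinal (coarsen_subproof e i).

(* The side exponent k + l of ext_l(A) is passed as any N provably equal to it,
   so that tensors coming from different levels k have the same type. *)
Definition ext (R : realType) (b d k l N : nat) (e : (k + l)%N = N)
    (A : tensor R (b ^ k) d) : tensor R (b ^ N) d :=
  fun i => A [ffun j => coarsen e (i j)].

(* The value of the j-th summation index (from 0), and the dummy value 0 when j
   is out of range: the first core has no left index and the last core no right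
   index. *)
Definition bond (m : nat) (rho : m.-tuple nat)
    (alpha : {dffun forall j : 'I_m, 'I_(tnth rho j)}) (j : nat) : nat :=
  if insub j is Some j' then alpha j' else 0%N.

Definition left_bond (m : nat) (rho : m.-tuple nat)
    (alpha : {dffun forall j : 'I_m, 'I_(tnth rho j)}) (j : nat) : nat :=
  if j is j'.+1 then bond alpha j' else 0%N.

(* Only the values of the cores G j at bonds in range matter.  If a component
   of rho is 0, the sum is empty and the tensor is zero. *)
Definition tt_rank_le (R : realType) (n d : nat) (rho : d.-1.-tuple nat)
    (A : tensor R n d) : Prop :=
  exists G : 'I_d -> nat -> 'I_n -> nat -> R,
    forall i : {ffun 'I_d -> 'I_n},
      A i = \sum_(alpha : {dffun forall j : 'I_d.-1, 'I_(tnth rho j)})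
              \prod_(j < d) G j (left_bond alpha j) (i j) (bond alpha j).

Definition MS_TT (R : realType) (b L d : nat)
    (r : 'I_L.+1 -> d.-1.-tuple nat) : set (tensor R (b ^ L) d) :=
  [set A | exists T : forall k : 'I_L.+1, tensor R (b ^ k) d,
      (forall k, tt_rank_le (r k) (T k)) /\
      forall i, A i = \sum_(k < L.+1) ext (subnKC (leq_ord k)) (T k) i].

Definition first_rank (m : nat) (rho : m.-tuple nat) : nat := nth 0%N rho 0.

Definition zero_or_positive (m : nat) (rho : m.-tuple nat) : Prop :=
  (forall j, tnth rho j = 0%N) \/ (forall j, (0 < tnth rho j)%N).

Arguments MS_TT R b {L d} r.

(* Main.v *)
(* Non-closedness already occurs for matrices; a matrix A with a bad limit gives
   the tensor of order d whose entries are A(i_1, i_2).  With n = b^k and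
   1 the all-ones vector, the rank-one matrices e^-1 (1 + e x)(1 + e y)^T differ
   from e^-1 1 1^T, which lies in every coarser level, by a matrix that tends to
   x 1^T + 1 y^T, of rank two.  So x 1^T + 1 y^T + Y with rank Y <= r - 1 is a
   limit of elements of the format.  To make sure that no block-constant S
   brings its rank down to r, it is cut out of an invertible diagonal matrix Q
   such that the diagonal of Q^-1 sums to zero on each block: then
   (Q^-1 S)^2 = 0, so Q - S is invertible for every block-constant S, while Q
   minus the limit has rank at most n - r - 1.
   In the closed cases the format is cut out by linear equations (being constant
   on blocks) and the vanishing of minors. *)

Require Import Defs.
From mathcomp Require Import all_boot all_order all_algebra.
From mathcomp Require Import all_classical all_reals all_analysis.
From mathcomp Require Import ring zify.

Set Implicit Arguments.
Unset Strict Implicit.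
Unset Printing Implicit Defensive.

Import numFieldNormedType.Exports.
Import Order.TTheory GRing.Theory Num.Theory.
Local Open Scope ring_scope.
Local Open Scope classical_set_scope.

(** * The diagonal matrix Q and block-constant perturbations *)

(* The diagonal entries of Q^-1. *)
Definition block_weight (F : realFieldType) (b i : nat) : F :=
  if (i %% b == b.-1)%N then 1 - b%:R else 1.

Lemma block_weight_neq0 (F : realFieldType) (b i : nat) :
  (1 < b)%N -> block_weight F b i != 0.
Proof.
move=> b_gt1; rewrite /block_weight; case: ifP => _; last exact: oner_neq0.
by rewrite subr_eq0 eq_sym pnatr_eq1 gtn_eqF.
Qed.

Lemma sum_block_weight (F : realFieldType) (b : nat) :
  (0 < b)%N -> \sum_(0 <= i < b) block_weight F b i = 0.
Proof.
case: b => // b _; rewrite big_nat_recr //= big_nat.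
rewrite (eq_bigr (fun=> 1)) => [|i /andP[_ ltib]]; last first.
  by rewrite /block_weight modn_small 1?ltnW //= ltn_eqF.
rewrite -big_nat big_const_nat subn0 iter_addr_0 /block_weight.
by rewrite modn_small //= eqxx -[b.+1]addn1 natrD; ring.
Qed.

Definition same_block (b n : nat) (i j : 'I_n) : Prop := (i %/ b = j %/ b)%N.
Arguments same_block b {n} i j.

(** On each of the m blocks f is a common factor, and the weights of a block add up to zero. *)
Lemma sum_block_weightM (F : realFieldType) (b m n : nat) (f : 'I_n -> F) :
  (0 < b)%N -> n = (m * b)%N ->
  (forall i j, same_block b i j -> f i = f j) ->
  \sum_(i < n) block_weight F b i * f i = 0.
Proof.
move=> b_gt0 n_eq f_const; pose g k := oapp f 0 (insub k : option 'I_n).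
have gE (i : 'I_n) : f i = g i by rewrite /g valK.
under eq_bigr do rewrite gE.
rewrite -(big_mkord xpredT (fun k => block_weight F b k * g k)) n_eq.
rewrite big_nat_mul big_nat big1 // => c /andP[_ lt_cm].
have lt_blk j : (j < b -> j + c * b < n)%N by nia.
rewrite -[X in \sum_(X <= _ < _) _]add0n big_addn -mulnBl subSn // subnn mul1n.
rewrite big_nat (eq_bigr (fun j => block_weight F b j * g (c * b)%N)).
  by rewrite -big_nat -mulr_suml sum_block_weight ?mul0r.
move=> j /andP[_ lt_jb]; congr (_ * _).
  by rewrite /block_weight addnC modnMDl.
have lt0 := lt_blk _ b_gt0; rewrite add0n in lt0.
rewrite -[RHS](gE (Ordinal lt0)) -(gE (Ordinal (lt_blk _ lt_jb))).
apply: f_const; rewrite /same_block /= addnC divnMDl // divn_small // addn0.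
by rewrite mulnK.
Qed.

Definition weight_mx (F : realFieldType) (b n : nat) : 'M[F]_n :=
  diag_mx (\row_j (block_weight F b j)^-1).

(** Let x Q = x S = y and let p be the weight. Then x_j = p_j y_j with y block-constant, so y_j is
    the p-weighted sum over i of the block-constant y_i S_ij, hence zero. *)
Lemma rank_weight_mxB (F : realFieldType) (b m n : nat) (S : 'M[F]_n) :
  (1 < b)%N -> n = (m * b)%N ->
  (forall i i' j j', same_block b i i' -> same_block b j j' ->
    S i j = S i' j') ->
  \rank (weight_mx F b n - S) = n.
Proof.
move=> b_gt1 n_eq S_const; apply/eqP/inj_row_free => x.
rewrite mulmxBr => /eqP; rewrite subr_eq0 => /eqP xQS.
pose y j := (x *m S) 0 j.
have xE j : x 0 j = block_weight F b j * y j.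
  rewrite /y -xQS mul_mx_diag !mxE mulrC divfK //; exact: block_weight_neq0.
have y0 j : y j = 0.
  rewrite /y mxE; under eq_bigr do rewrite xE -mulrA.
  apply: (@sum_block_weightM _ _ m) => // [|i i' ii']; first exact: ltnW.
  congr (_ * _); last exact: S_const.
  by rewrite /y !mxE; apply: eq_bigr => l _; congr (_ * _); apply: S_const.
by apply/rowP => j; rewrite xE y0 mulr0 mxE.
Qed.

(** * Rank-one decomposition of Q and the limit matrix *)

Lemma rank_sum_le (F : fieldType) (n a c : nat) (M : nat -> 'M[F]_n) :
  (forall k, \rank (M k) <= 1)%N ->
  (\rank (\sum_(a <= k < c) M k)%R <= c - a)%N.
Proof.
move=> M_le1; rewrite -[(c - a)%N]muln1 -sum_nat_const_nat.
elim/big_rec2: _ => [|k N m _ IH]; first by rewrite mxrank0.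
exact: leq_trans (mxrank_add _ _) (leq_add (M_le1 k) IH).
Qed.

(* Writing p for block_weight, [weight_term k] is
   (e_k - p_k/p_0 e_0) (p_k^-1 e_k - p_1^-1 e_1)^T; it vanishes for k = 0, 1. *)
Definition weight_term (F : realFieldType) (b n k : nat) : 'M[F]_n :=
  (\col_i ((i == k :> nat)%:R -
     (block_weight F b 0)^-1 * block_weight F b k * (i == 0 :> nat)%:R)) *m
  (\row_j ((block_weight F b k)^-1 * (j == k :> nat)%:R -
     (block_weight F b 1)^-1 * (j == 1 :> nat)%:R)).

(* x 1^T + 1 y^T with x = p_0^-1 e_0 and y = p_1^-1 e_1. *)
Definition border_mx (F : realFieldType) (b n : nat) : 'M[F]_n :=
  \matrix_(i, j) ((block_weight F b 0)^-1 * (i == 0 :> nat)%:R +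
                  (block_weight F b 1)^-1 * (j == 1 :> nat)%:R).

(** Expand the product and sum over all k: the four parts give Q, minus the two summands of
    [border_mx], and a multiple of the total weight, which is zero. *)
Lemma weight_mxE (F : realFieldType) (b m n : nat) :
  (1 < b)%N -> n = (m * b)%N -> (0 < m)%N ->
  weight_mx F b n = border_mx F b n + \sum_(2 <= k < n) weight_term F b n k.
Proof.
move=> b_gt1 n_eq m_gt0; apply/matrixP => i j.
have p_neq0 k : block_weight F b k != 0 by exact: block_weight_neq0.
have n_gt1 : (1 < n)%N by nia.
pose t k := ((i == k :> nat)%:R -
     (block_weight F b 0)^-1 * block_weight F b k * (i == 0 :> nat)%:R) *
  ((block_weight F b k)^-1 * (j == k :> nat)%:R -
     (block_weight F b 1)^-1 * (j == 1 :> nat)%:R) : F.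
rewrite !mxE summxE (eq_bigr t) => [|k _]; last by rewrite mxE big_ord1 !mxE.
have -> : \sum_(2 <= k < n) t k = \sum_(k < n) t k.
  rewrite -(big_mkord xpredT t) big_ltn ?(ltnW n_gt1) // big_ltn //.
  have -> : t 0%N = 0 by rewrite /t mulVf // mul1r subrr mul0r.
  have -> : t 1%N = 0 by rewrite /t subrr mulr0.
  by rewrite !add0r.
pose p k := block_weight F b k.
have delta (x : 'I_n) (g : nat -> F) :
    \sum_(k < n) (x == k :> nat)%:R * g k = g x.
  rewrite (bigD1 x) //= eqxx mul1r big1 ?addr0 // => k.
  by rewrite eq_sym => /negbTE nkx; rewrite -[_ == _]/(x == k) nkx mul0r.
have tE k : t k = (i == k :> nat)%:R * ((p k)^-1 * (j == k :> nat)%:R) -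
    (i == k :> nat)%:R * ((p 1%N)^-1 * (j == 1 :> nat)%:R) -
    (j == k :> nat)%:R * ((p 0%N)^-1 * (i == 0 :> nat)%:R) +
    p k * ((p 0%N)^-1 * (p 1%N)^-1 * (i == 0 :> nat)%:R * (j == 1 :> nat)%:R).
  by rewrite /t -/(p k) -/(p 0%N) -/(p 1%N); field; rewrite !p_neq0.
rewrite (eq_bigr (fun k : 'I_n => _) (fun k _ => tE k)) !big_split /=.
rewrite !sumrN.
rewrite (delta i (fun k => (p k)^-1 * (j == k :> nat)%:R)).
rewrite (delta i (fun k => (p 1%N)^-1 * (j == 1 :> nat)%:R)).
rewrite (delta j (fun k => (p 0%N)^-1 * (i == 0 :> nat)%:R)).
have -> : \sum_(k < n) p k * ((p 0%N)^-1 * (p 1%N)^-1 *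
    (i == 0 :> nat)%:R * (j == 1 :> nat)%:R) = 0.
  by apply: (@sum_block_weightM _ _ m) => //; exact: ltnW.
rewrite addr0 [(j == i :> nat)]eq_sym -/(p i) -mulr_natr.
by rewrite -[(i == j :> nat)]/(i == j); ring.
Qed.

(** For 0 < r < n the sum has r - 1 terms, so n - r - 1 terms of [weight_mxE] are left over. *)
Definition limit_mx (F : realFieldType) (b n r : nat) : 'M[F]_n :=
  border_mx F b n + \sum_(2 <= k < r.+1) weight_term F b n k.

(* x y^T, the second order term of (1 + e x)(1 + e y)^T. *)
Definition corner_mx (F : realFieldType) (b n : nat) : 'M[F]_n :=
  \matrix_(i, j) ((block_weight F b 0)^-1 * (i == 0 :> nat)%:R *
                  ((block_weight F b 1)^-1 * (j == 1 :> nat)%:R)).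

Lemma rank_weight_term (F : realFieldType) (b n k : nat) :
  (\rank (weight_term F b n k) <= 1)%N.
Proof. exact: mulmx_max_rank. Qed.

(** The parts outside the sum form the single rank-one matrix e^-1 (1 + e x)(1 + e y)^T, which
    leaves room for the r - 1 terms. *)
Lemma rank_limit_mx_approx (F : realFieldType) (b n r : nat) (e : F) :
  (0 < r)%N -> e != 0 ->
  (\rank (limit_mx F b n r + e *: corner_mx F b n + e^-1 *: const_mx 1)%R
     <= r)%N.
Proof.
move=> r_gt0 e_neq0.
pose u : 'cV[F]_n :=
  \col_i (e^-1 + (block_weight F b 0)^-1 * (i == 0 :> nat)%:R).
pose v : 'rV[F]_n :=
  \row_j (1 + e * ((block_weight F b 1)^-1 * (j == 1 :> nat)%:R)).
have -> : limit_mx F b n r + e *: corner_mx F b n + e^-1 *: const_mx 1 =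
    u *m v + \sum_(2 <= k < r.+1) weight_term F b n k.
  rewrite /limit_mx (addrAC (border_mx _ _ _)) (addrAC (border_mx _ _ _ + _)).
  congr (_ + _).
  apply/matrixP => i j; rewrite !mxE big_ord1 !mxE.
  set x := _ * (i == 0 :> nat)%:R; set y := _ * (j == 1 :> nat)%:R.
  by field.
rewrite -[leqRHS](subnKC r_gt0) -subSS.
apply: leq_trans (mxrank_add _ _) (leq_add _ _); first exact: mulmx_max_rank.
exact: rank_sum_le (@rank_weight_term F b n).
Qed.

(** Adding the n - r - 1 left-over terms, of rank at most one each, gives Q - S, of rank n. *)
Lemma rank_limit_mxB (F : realFieldType) (b m n r : nat) (S : 'M[F]_n) :
  (1 < b)%N -> n = (m * b)%N -> (0 < r < n)%N ->
  (forall i i' j j', same_block b i i' -> same_block b j j' ->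
    S i j = S i' j') ->
  (r < \rank (limit_mx F b n r - S)%R)%N.
Proof.
move=> b_gt1 n_eq /andP[r_gt0 lt_rn] S_const.
have m_gt0 : (0 < m)%N by nia.
have := rank_weight_mxB b_gt1 n_eq S_const.
have -> : weight_mx F b n - S =
    limit_mx F b n r - S + \sum_(r.+1 <= k < n) weight_term F b n k.
  rewrite (weight_mxE F b_gt1 n_eq m_gt0) (big_cat_nat (n := r.+1)) //.
  by rewrite /limit_mx addrA [LHS]addrAC.
move=> rank_n; rewrite -(leq_add2r (n - r.+1)) subnKC // -[leqLHS]rank_n.
apply: leq_trans (mxrank_add _ _) _; rewrite leq_add2l.
exact: rank_sum_le (@rank_weight_term F b n).
Qed.


(** * Continuity of determinants and closedness of rank bounds *)

Lemma continuous_sum (R : realType) (X : topologicalType) (I : finType)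
    (P : pred I) (f : I -> X -> R) :
  (forall i, P i -> continuous (f i)) ->
  continuous (fun x => \sum_(i | P i) f i x).
Proof.
by move=> f_cont; apply: continuous_big f_cont; exact: add_continuous.
Qed.

Lemma continuous_prod (R : realType) (X : topologicalType) (I : finType)
    (P : pred I) (f : I -> X -> R) :
  (forall i, P i -> continuous (f i)) ->
  continuous (fun x => \prod_(i | P i) f i x).
Proof.
by move=> f_cont; apply: continuous_big f_cont; exact: mul_continuous.
Qed.

Lemma continuous_det (R : realType) (X : topologicalType) (n : nat)
    (F : X -> 'M[R]_n) :
  (forall i j, continuous (fun x => F x i j)) ->
  continuous (fun x => \det (F x)).
Proof.
move=> F_cont; apply: continuous_sum => s _ x.
apply: cvgM; first exact: cvg_cst.
by apply: continuous_prod => i _; exact: F_cont.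
Qed.

Lemma continuous_mulmx (R : realType) (X : topologicalType) (m n p : nat)
    (F : X -> 'M[R]_(m, n)) (G : X -> 'M[R]_(n, p)) :
  (forall i j, continuous (fun x => F x i j)) ->
  (forall i j, continuous (fun x => G x i j)) ->
  forall i j, continuous (fun x => (F x *m G x) i j).
Proof.
move=> F_cont G_cont i j.
under eq_fun do rewrite mxE.
by apply: continuous_sum => k _ x; apply: cvgM; [exact: F_cont|exact: G_cont].
Qed.

(** These products stand in for minors: no choice of rows and columns is needed, and each
    determinant is polynomial in [A]. *)
Lemma rank_le_det (F : fieldType) (m n r : nat) (A : 'M[F]_(m, n)) :
  (\rank A <= r)%N <->
  forall (U : 'M[F]_(r.+1, m)) (V : 'M[F]_(n, r.+1)), \det (U *m A *m V) = 0.
Proof.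
split=> [rankA U V|det0].
  apply/eqP; apply/negPn/negP; rewrite -unitfE -unitmxE.
  move=> /mxrank_unit rUAV.
  have := leq_trans (mxrankM_maxl _ V) (mxrankM_maxr U A).
  by rewrite rUAV leqNgt ltnS rankA.
rewrite leqNgt; apply/negP => lt_r.
have [lt_m lt_n] : (r < m /\ r < n)%N.
  by split; apply: leq_trans lt_r _; [exact: rank_leq_row|exact: rank_leq_col].
(* If the rank exceeds r, this [U] and [V] cut the identity of size r + 1 out of the normal form of
   [A]. *)
have /eqP := det0 (pid_mx r.+1 *m invmx (col_ebase A))
  (invmx (row_ebase A) *m pid_mx r.+1).
rewrite -{2}(mulmx_ebase A) !mulmxA mulmxKV ?col_ebase_unit //.
rewrite mulmxK ?row_ebase_unit // !mul_pid_mx.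
have -> : minn n (minn (minn m (minn r.+1 (\rank A))) r.+1) = r.+1 by lia.
by rewrite pid_mx_1 det1 oner_eq0.
Qed.

Lemma closed_eq_fun (R : realType) (X : topologicalType) (f g : X -> R) :
  continuous f -> continuous g -> closed [set x | f x = g x].
Proof.
move=> f_cont g_cont.
have -> : [set x | f x = g x] = (fun x => f x - g x) @^-1` [set 0].
  apply/seteqP; split=> x /= fg; first by rewrite fg subrr.
  by apply/eqP; rewrite -subr_eq0 fg.
apply: preimage_closed; last exact: closed_eq.
by move=> x _; apply: cvgB; [exact: f_cont|exact: g_cont].
Qed.

Lemma closed_rank_le (R : realType) (X : topologicalType) (m n r : nat)
    (F : X -> 'M[R]_(m, n)) :
  (forall i j, continuous (fun x => F x i j)) ->
  closed [set x | (\rank (F x) <= r)%N].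
Proof.
move=> F_cont.
have -> : [set x | (\rank (F x) <= r)%N] =
    \bigcap_(UV in [set: 'M[R]_(r.+1, m) * 'M[R]_(n, r.+1)])
      ((fun x => \det (UV.1 *m F x *m UV.2)) @^-1` [set 0]).
  apply/seteqP; split=> x /=.
    by move=> /rank_le_det det0 [U V] _; exact: det0.
  by move=> det0; apply/rank_le_det => U V; exact: (det0 (U, V)).
apply: closed_bigI => -[U V] _; apply: preimage_closed; last exact: closed_eq.
move=> x _; apply: continuous_det.
apply: continuous_mulmx => [|i j]; last first.
  by move=> y; exact: cvg_cst.
by apply: continuous_mulmx => // i j y; exact: cvg_cst.
Qed.


(** * Matrix rank and tensor-train rank *)

(** The inner index is a natural number, to fit the cores of [tt_rank_le]; both factors are zero
    from [\rank A] on. *)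
Lemma rank_le_outer (F : fieldType) (m n r : nat) (A : 'M[F]_(m, n)) :
  (\rank A <= r)%N ->
  exists (X : 'I_m -> nat -> F) (Y : nat -> 'I_n -> F),
    forall i j, A i j = \sum_(a < r) X i a * Y a j.
Proof.
move=> le_r.
exists (fun i a => oapp (col_base A i) 0 (insub a)).
exists (fun a j => oapp (fun a' => row_base A a' j) 0 (insub a)).
move=> i j; pose t a : F := oapp (col_base A i) 0 (insub a) *
  oapp (fun a' => row_base A a' j) 0 (insub a).
rewrite (bigID (fun a : 'I_r => a < \rank A)%N) /=.
rewrite [X in _ = _ + X]big1 => [|a]; last first.
  by rewrite -leqNgt => le_a; rewrite insubN -?leqNgt //= mul0r.
rewrite addr0 -(big_ord_widen _ t le_r) -{1}(mulmx_base A) mxE.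
by apply: eq_bigr => a _; rewrite /t valK.
Qed.

Section TensorTrain.

Variables (R : realType) (n d : nat).
Implicit Types (rho : d.+1.-tuple nat) (A : tensor R n d.+2).

Let slice_index (x y : 'I_n) : {ffun 'I_d.+2 -> 'I_n} :=
  [ffun j => if j == ord0 then x else y].

Lemma first_rankE rho : first_rank rho = tnth rho ord0.
Proof. by rewrite (tnth_nth 0%N). Qed.

Lemma bondE rho (alpha : {dffun forall j : 'I_d.+1, 'I_(tnth rho j)})
    (j : 'I_d.+1) : bond alpha j = alpha j.
Proof. by rewrite /bond valK. Qed.

Lemma tt_rank_le0 rho :
  tt_rank_le (d := d.+2) rho ((fun=> 0) : tensor R n d.+2).
Proof.
exists (fun _ _ _ _ => 0) => i.
by rewrite big1 // => a _; rewrite big_ord_recl mul0r.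
Qed.

Lemma tt_rank_le_eq0 rho A : tnth rho ord0 = 0%N ->
  tt_rank_le (d := d.+2) rho A -> forall i, A i = 0.
Proof.
move=> rho0 [G AE] i; rewrite AE big1 // => alpha _.
by have := leq_ltn_trans (leq0n _) (ltn_ord (alpha ord0)); rewrite rho0.
Qed.

(* The slice is a submatrix of the first unfolding of A. *)
Lemma rank_slice_le rho A : tt_rank_le (d := d.+2) rho A ->
  (\rank (\matrix_(x, y) A (slice_index x y))%R <= first_rank rho)%N.
Proof.
move=> [G AE]; rewrite first_rankE.
(* Grouping by the first bond: [X] is the first core, [Y] sums the rest of the train. *)
pose X := \matrix_(x < n, a < tnth rho ord0) G ord0 0%N x a.
pose Y := \matrix_(a < tnth rho ord0, y < n)
  \sum_(alpha : {dffun forall j : 'I_d.+1, 'I_(tnth rho j)} | alpha ord0 == a)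
    \prod_(j < d.+1) G (lift ord0 j) (left_bond alpha (lift ord0 j)) y
                       (bond alpha (lift ord0 j)).
suff -> : \matrix_(x, y) A (slice_index x y) = X *m Y by exact: mulmx_max_rank.
apply/matrixP => x y; rewrite !mxE AE.
rewrite (partition_big
  (fun alpha : {dffun forall j, 'I_(tnth rho j)} => alpha ord0) xpredT) //=.
apply: eq_bigr => a _; rewrite !mxE mulr_sumr.
apply: eq_bigr => alpha /eqP <-.
rewrite [LHS]big_ord_recl /slice_index ffunE eqxx -(bondE alpha ord0).
congr (_ * _).
by apply: eq_bigr => j _; rewrite ffunE.
Qed.

(** The first two cores carry [X] and [Y]; all bonds after the first are pinned to 0, a value
    available because the ranks are positive. *)
Lemma tt_rank_le_outer rho (X : 'I_n -> nat -> R) (Y : nat -> 'I_n -> R) :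
  (forall j, 0 < tnth rho j)%N ->
  tt_rank_le (d := d.+2) rho
    ((fun i => \sum_(a < tnth rho ord0) X (i ord0) a * Y a (i (lift ord0 ord0)))
     : tensor R n d.+2).
Proof.
move=> rho_gt0.
(* The last core sees the dummy right bond 0, so its factor [c == 0] is 1. *)
exists (fun j a x c =>
  if j == ord0 then X x c
  else (if j == lift ord0 ord0 then Y a x else 1) * (c == 0%N)%:R) => i.
rewrite [RHS](partition_big
  (fun alpha : {dffun forall j, 'I_(tnth rho j)} => alpha ord0) xpredT) //=.
apply: eq_bigr => a _.
pose beta : {dffun forall j : 'I_d.+1, 'I_(tnth rho j)} :=
  [ffun j => insubd (Ordinal (rho_gt0 j)) (if j == ord0 then val a else 0%N)].
have betaE j : val (beta j) = if j == ord0 then val a else 0%N.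
  rewrite /beta ffunE val_insubd; case: eqP => [->|_]; first by rewrite ltn_ord.
  by rewrite rho_gt0.
rewrite (bigD1 beta) /=; last by apply/eqP/val_inj; rewrite betaE eqxx.
rewrite [X in _ = _ + X]big1 ?addr0.
  have bond_beta k : bond beta k = if k == 0%N then val a else 0%N.
    rewrite /bond; case: insubP => [j _ <-|]; first by rewrite betaE.
    by rewrite -leqNgt; case: k.
  rewrite 2![\prod_(j < _) _]big_ord_recl /= !bond_beta /= mulr1.
  by rewrite big1 => [|j _]; rewrite ?mulr1 // bond_beta eqxx mulr1.
move=> alpha /andP[/eqP alpha0 neq].
have [j neq_j] : exists j, alpha j != beta j.
  apply/existsP; rewrite -negb_forall; apply: contra neq => /forallP eq_ab.
  by apply/eqP/ffunP => j; apply/eqP/eq_ab.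
have j_neq0 : j != ord0.
  apply: contraNneq neq_j => ->; rewrite alpha0; apply/eqP/val_inj.
  by rewrite betaE eqxx.
(* Core j has the nonzero right bond [alpha j], so it vanishes. *)
rewrite (bigD1 (widen_ord (leqnSn _) j)) //=.
rewrite -[_ == ord0]/(j == ord0) (negbTE j_neq0) bondE.
move: neq_j; rewrite -val_eqE betaE (negbTE j_neq0) => /negbTE /= ->.
by rewrite mulr0 mul0r.
Qed.

End TensorTrain.


Lemma tt_rank_le_mx (R : realType) (n d : nat) (rho : d.+1.-tuple nat)
    (M : 'M[R]_n) :
  (forall j, 0 < tnth rho j)%N -> (\rank M <= first_rank rho)%N ->
  tt_rank_le (d := d.+2) rho
    ((fun i => M (i ord0) (i (lift ord0 ord0))) : tensor R n d.+2).
Proof.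
move=> rho_gt0; rewrite first_rankE => /rank_le_outer[X [Y ME]].
have [G GE] := @tt_rank_le_outer R n d rho X Y rho_gt0.
by exists G => i; rewrite ME GE.
Qed.

(** The case r = 0 is separate because [tt_rank_le_mx] asks for positive ranks. *)
Lemma tt_rank_le_matrix (R : realType) (n r : nat) (M : 'M[R]_n) :
  (\rank M <= r)%N ->
  tt_rank_le (d := 2) [tuple r]
    ((fun i => M (i ord0) (i ord_max)) : tensor R n 2).
Proof.
have -> : ord_max = lift ord0 ord0 :> 'I_2 by exact: val_inj.
case: r => [|r] le_r; last first.
  by apply: tt_rank_le_mx => // j; rewrite (tnth_nth 0%N); case: j => -[].
have [G GE] := @tt_rank_le0 R n 0 [tuple 0%N].
exists G => i; rewrite -GE; move: le_r; rewrite leqn0 mxrank_eq0 => /eqP ->.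
by rewrite mxE.
Qed.

(** * Passage between the index sets of different levels *)

Lemma refine_subproof (b k l N : nat) (b_gt0 : (0 < b)%N) (e : (k + l)%N = N)
  (i : 'I_(b ^ k)) : (i * b ^ l < b ^ N)%N.
Proof. by rewrite -[in X in (_ < X)%N]e expnD ltn_pmul2r ?expn_gt0 ?b_gt0. Qed.

(** The first fine index of a block, so that level-k data can be sampled from an extended tensor. *)
Definition refine (b k l N : nat) (b_gt0 : (0 < b)%N) (e : (k + l)%N = N)
    (i : 'I_(b ^ k)) : 'I_(b ^ N) :=
  Ordinal (refine_subproof b_gt0 e i).

Lemma refineK (b k l N : nat) (b_gt0 : (0 < b)%N) (e : (k + l)%N = N) :
  cancel (refine b_gt0 e) (coarsen e).
Proof. by move=> i; apply: val_inj; rewrite /= mulnK // expn_gt0 b_gt0. Qed.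

(** Level j is at least a factor b coarser than k and sees only the quotient by b; so the coarser
    levels enter [rank_limit_mxB] as a block-constant [S]. *)
Lemma coarsen_refine_eq (b j k N : nat) (lj lk : nat) (b_gt0 : (0 < b)%N)
    (ej : (j + lj)%N = N) (ek : (k + lk)%N = N) (x y : 'I_(b ^ k)) :
  (j < k)%N -> same_block b x y ->
  coarsen ej (refine b_gt0 ek x) = coarsen ej (refine b_gt0 ek y).
Proof.
move=> lt_jk xy; apply: val_inj => /=.
have -> : lj = (1 + (k - j.+1) + lk)%N by lia.
by rewrite !expnD !divnMr ?expn_gt0 ?b_gt0 // expn1 !divnMA xy.
Qed.

Lemma coarsen_refine_coarsen (b j k N : nat) (lj lk : nat) (b_gt0 : (0 < b)%N)
    (ej : (j + lj)%N = N) (ek : (k + lk)%N = N) (i : 'I_(b ^ N)) :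
  (j <= k)%N -> coarsen ej (refine b_gt0 ek (coarsen ek i)) = coarsen ej i.
Proof.
move=> le_jk; apply: val_inj => /=.
have -> : lj = (lk + (k - j))%N by lia.
by rewrite !expnD !divnMA mulnK // expn_gt0 b_gt0.
Qed.

Definition lifted_slice (b k l N d : nat) (b_gt0 : (0 < b)%N)
    (e : (k + l)%N = N) (x y : 'I_(b ^ k)) : {ffun 'I_d.+2 -> 'I_(b ^ N)} :=
  [ffun j => refine b_gt0 e (if j == ord0 then x else y)].

Lemma ext_lifted_slice (R : realType) (b k l N d : nat) (b_gt0 : (0 < b)%N)
    (e : (k + l)%N = N) (A : tensor R (b ^ k) d.+2) (x y : 'I_(b ^ k)) :
  ext e A (lifted_slice d b_gt0 e x y) =
  A [ffun j => if j == ord0 then x else y].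
Proof. by congr A; apply/ffunP => j; rewrite !ffunE refineK. Qed.

Lemma ext0 (R : realType) (b k l N d : nat) (e : (k + l)%N = N)
    (A : tensor R (b ^ k) d) : (forall i, A i = 0) -> forall i, ext e A i = 0.
Proof. by move=> A0 i; rewrite /ext A0. Qed.

(** * Entrywise convergence and the failure of closedness *)

Lemma continuous_entry (R : realType) (n d : nat) (i : {ffun 'I_d -> 'I_n}) :
  continuous (fun A : tensor R n d => A i).
Proof. exact: (@proj_continuous _ (fun=> R) i). Qed.

Lemma cvg_entrywise (R : realType) (n d : nat) (u : nat -> tensor R n d)
    (A : tensor R n d) :
  (forall i, u m i @[m --> \oo] --> A i) -> u m @[m --> \oo] --> A.
Proof.
move=> u_cvg; apply/cvg_sup => i B [_ [[W oW <-] WA WB]].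
apply: (filterS WB); apply: u_cvg.
by apply: open_nbhs_nbhs; split.
Qed.

(** If the limit [U 0] were in the format, taking the other levels away from its slice would leave a
    slice of [T k], of rank at most r_k, against [rank_limit_mxB]. *)
Lemma MS_TT_not_closed (R : realType) (b L d : nat)
    (r : 'I_L.+1 -> d.+1.-tuple nat) (k k' : 'I_L.+1) :
  (1 < b)%N -> (forall i, zero_or_positive (r i)) ->
  (forall i : 'I_L.+1, (k < i)%N -> forall j, tnth (r i) j = 0%N) ->
  (0 < first_rank (r k) < b ^ k)%N ->
  (k' < k)%N -> (0 < first_rank (r k'))%N ->
  ~ closed (MS_TT R b (d := d.+2) r).
Proof.
move=> b_gt1 r_zp r_eq0 rk_bounds lt_k'k rk'_gt0 MS_closed.
have /andP[rk_gt0 rk_lt] := rk_bounds.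
have b_gt0 := ltnW b_gt1.
set rk := first_rank (r k) in rk_bounds rk_gt0 rk_lt *.
have r_gt0 i : (0 < first_rank (r i))%N -> forall j, (0 < tnth (r i) j)%N.
  by rewrite first_rankE; case: (r_zp i) => // ->.
(* The exponent j stays variable because the test [j == k] in the witness below does not identify
   the types of the levels. *)
pose M j e : 'M[R]_(b ^ j) :=
  limit_mx R b (b ^ j) rk + e *: corner_mx R b (b ^ j).
pose U e : tensor R (b ^ L) d.+2 := ext (subnKC (leq_ord k))
  ((fun i => M k e (i ord0) (i (lift ord0 ord0))) : tensor R (b ^ k) d.+2).
have MS_U e : e != 0 -> MS_TT R b (d := d.+2) r (U e).
  move=> e_neq0.
  (* Level k takes the term e^-1 that brings its rank down to at most r_k; level k' removes it by a
     constant matrix of rank at most one. *)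
  exists (fun j i =>
    if j == k then (M j e + e^-1 *: const_mx 1) (i ord0) (i (lift ord0 ord0))
    else if j == k' then
      (const_mx (- e^-1) : 'M[R]_(b ^ j)) (i ord0) (i (lift ord0 ord0))
    else 0).
  split=> [j|i].
    case: eqP => [->|_].
      apply: tt_rank_le_mx (r_gt0 _ _) _ => //.
      exact: rank_limit_mx_approx.
    case: eqP => [->|_]; last exact: tt_rank_le0.
    apply: tt_rank_le_mx (r_gt0 _ _) _ => //; apply: leq_trans rk'_gt0.
    have -> : const_mx (- e^-1) = (const_mx (- e^-1) : 'cV[R]_(b ^ k')) *m
        (const_mx 1 : 'rV[R]_(b ^ k')).
      by apply/matrixP => x y; rewrite !mxE big_ord1 !mxE mulr1.
    exact: mulmx_max_rank.
  have k'k : k' != k by rewrite -val_eqE /= ltn_eqF.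
  rewrite (bigD1 k) //= (bigD1 k') //= big1 => [|j /andP[jk jk']]; last first.
    by rewrite ext0 // => ?; rewrite (negbTE jk) (negbTE jk').
  by rewrite /U /ext eqxx (negbTE k'k) eqxx !mxE; ring.
have [T [T_rank TE]] : MS_TT R b (d := d.+2) r (U 0).
  apply: (@closed_cvg _ _ \oo _ (fun n => U n.+1%:R^-1) _ MS_closed _ (U 0)).
    by apply: nearW => n; apply: MS_U; rewrite invr_neq0.
  apply: cvg_entrywise => i; rewrite /U /ext.
  set x := _ ord0; set y := _ (lift _ _).
  have ME e : M k e x y =
      limit_mx R b (b ^ k) rk x y + e * corner_mx R b (b ^ k) x y.
    by rewrite /M !mxE.
  rewrite ME; under eq_fun do rewrite ME.
  apply: cvgD; first exact: cvg_cst.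
  by apply: cvgM; [exact: cvg_harmonic|exact: cvg_cst].
(* The share of the other levels: finer ones are zero, coarser ones block-constant. *)
pose S : 'M[R]_(b ^ k) := \matrix_(x, y) \sum_(j < L.+1 | j != k)
  ext (subnKC (leq_ord j)) (T j)
    (lifted_slice d b_gt0 (subnKC (leq_ord k)) x y).
have n_eq : (b ^ k = b ^ k.-1 * b)%N.
  by rewrite -expnSr prednK //; apply: leq_ltn_trans lt_k'k.
have := @rank_limit_mxB R b _ _ rk S b_gt1 n_eq rk_bounds.
have -> : limit_mx R b (b ^ k) rk - S =
    \matrix_(x, y) T k [ffun j => if j == ord0 then x else y].
  apply/matrixP => x y.
  have := TE (lifted_slice d b_gt0 (subnKC (leq_ord k)) x y).
  rewrite /U ext_lifted_slice !ffunE /= (bigD1 k) //= ext_lifted_slice.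
  by rewrite /M scale0r addr0 !mxE => ->; rewrite addrK.
rewrite ltnNge rank_slice_le // => /(_ _)/negP; apply => // x x' y y' xx' yy'.
rewrite !mxE; apply: eq_bigr => j jk; rewrite /ext.
have [lt_jk|le_kj] := ltnP j k.
  congr (T j); apply/ffunP => i; rewrite !ffunE.
  by case: eqP => _; exact: coarsen_refine_eq.
have Tj0 : forall i, T j i = 0.
  apply: tt_rank_le_eq0 (T_rank j); apply: r_eq0.
  by rewrite ltn_neqAle le_kj eq_sym andbT.
by rewrite !Tj0.
Qed.

(** * The closed formats of matrices *)

(** The format consists of the tensors constant on level-k blocks whose matrix of block values has
    rank at most r_k. If r_k = b^k every matrix obeys the bound; in the other form level k alone
    contributes. *)
Lemma MS_TT_closed (R : realType) (b L : nat) (r : 'I_L.+1 -> nat)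
    (k : 'I_L.+1) :
  (0 < b)%N -> (forall i : 'I_L.+1, (k < i)%N -> r i = 0%N) ->
  r k = (b ^ k)%N \/ (forall i, i <> k -> r i = 0%N) ->
  closed (MS_TT R b (d := 2) (fun k => [tuple r k])).
Proof.
move=> b_gt0 r_eq0 r_form.
pose ek := subnKC (leq_ord k).
(* Invariance under [proj] expresses constancy on level-k blocks by linear equations. *)
pose proj (i : {ffun 'I_2 -> 'I_(b ^ L)}) : {ffun 'I_2 -> 'I_(b ^ L)} :=
  [ffun j => refine b_gt0 ek (coarsen ek (i j))].
pose mx (A : tensor R (b ^ L) 2) : 'M[R]_(b ^ k) :=
  \matrix_(x, y) A (lifted_slice 0 b_gt0 ek x y).
have T0 (j : 'I_L.+1) (T : tensor R (b ^ j) 2) : r j = 0%N ->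
    tt_rank_le (d := 2) [tuple r j] T -> forall i, T i = 0.
  by move=> rj0; apply: tt_rank_le_eq0; rewrite (tnth_nth 0%N).
have -> : MS_TT R b (d := 2) (fun k => [tuple r k]) =
    (\bigcap_i [set A | A i = A (proj i)]) `&`
    [set A | (\rank (mx A) <= r k)%N].
  apply/seteqP; split=> A /=.
    move=> [T [T_rank TE]]; split=> [i _ /=|].
      rewrite !TE; apply: eq_bigr => j _; rewrite /ext.
      have [le_jk|lt_kj] := leqP j k; last first.
        by rewrite !(T0 _ _ _ (T_rank j)) ?r_eq0.
      congr (T j); apply/ffunP => l; rewrite !ffunE.
      by rewrite coarsen_refine_coarsen.
    case: r_form => [->|r0]; first exact: rank_leq_row.
    suff -> : mx A = \matrix_(x, y) T k [ffun j => if j == ord0 then x else y].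
      exact: rank_slice_le (T_rank k).
    apply/matrixP => x y; rewrite !mxE TE (bigD1 k) //= ext_lifted_slice.
    rewrite big1 ?addr0 // => j /eqP jk; apply: ext0.
    by apply: T0 (T_rank j); exact: r0.
  move=> [A_proj rankA].
  exists (fun j i => if j == k then
    A (lifted_slice 0 b_gt0 (subnKC (leq_ord j)) (i ord0) (i ord_max)) else 0).
  split=> [j|i].
    case: (j =P k) => [->|_]; last exact: (@tt_rank_le0 R _ 0).
    have [G GE] := tt_rank_le_matrix rankA.
    by exists G => i; rewrite -GE mxE.
  rewrite (bigD1 k) //= big1 ?addr0 => [|j /negbTE jk]; last first.
    by rewrite /ext jk.
  rewrite /ext eqxx (A_proj i I).
  congr A; apply/ffunP => j; rewrite !ffunE.
  have [->//|j_neq0] := eqVneq j ord0.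
  suff -> : j = ord_max by [].
  by apply: val_inj; case: j j_neq0 => -[|[|]].
apply: closedI.
  apply: closed_bigI => i _.
  by apply: closed_eq_fun => A; exact: continuous_entry.
apply: closed_rank_le => x y.
have -> : (fun A => mx A x y) = (fun A => A (lifted_slice 0 b_gt0 ek x y)).
  by apply/funext => A; rewrite mxE.
exact: continuous_entry.
Qed.

Theorem theorem4p1 (R : realType) (b L : nat) (hb : (2 <= b)%N) (hL : (0 < L)%N) :
  (forall r : 'I_L.+1 -> nat,
     (forall k : 'I_L.+1, (r k <= b ^ k)%N) ->
     (closed (MS_TT R b (d := 2) (fun k => [tuple r k])) <->
      (exists k : 'I_L.+1,
         r k = (b ^ k)%N /\ forall i : 'I_L.+1, (k < i)%N -> r i = 0%N) \/
      (exists k : 'I_L.+1, forall i : 'I_L.+1, i <> k -> r i = 0%N)))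
  /\
  (forall (d : nat) (r : 'I_L.+1 -> d.-1.-tuple nat) (k : 'I_L.+1),
     (3 <= d)%N ->
     (forall i : 'I_L.+1, zero_or_positive (r i)) ->
     (forall i : 'I_L.+1, (k < i)%N -> forall j, tnth (r i) j = 0%N) ->
     (0 < first_rank (r k))%N ->
     (first_rank (r k) < b ^ k)%N ->
     ~ (forall i : 'I_L.+1, (i < k)%N -> first_rank (r i) = 0%N) ->
     ~ closed (MS_TT R b r)).
Proof.
split=> [r r_le|[|[|d]] r k // _ r_zp r_eq0 rk_gt0 rk_lt not_all0]; last first.
  move=> MS_closed; apply: not_all0 => k' lt_k'k.
  apply/eqP; rewrite -leqn0 leqNgt; apply/negP.
  move=> rk'_gt0; move: MS_closed.
  apply: MS_TT_not_closed lt_k'k rk'_gt0 => //.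
  by rewrite rk_gt0.
split=> [MS_closed|[[k [rk r_eq0]]|[k r_eq0]]]; last 2 first.
- by apply: (@MS_TT_closed _ _ _ _ k) => //; [exact: ltnW|left].
- apply: (@MS_TT_closed _ _ _ _ k); [exact: ltnW| |by right].
  by move=> i lt_ki; apply: r_eq0 => ik; rewrite ik ltnn in lt_ki.
(* If all ranks vanish, the second form holds with any k. *)
have [k1 rk1_gt0|r0] := pickP (fun i => 0 < r i)%N; last first.
  by right; exists ord0 => i _; apply/eqP; rewrite -leqn0 leqNgt r0.
(* Take the last nonzero rank; unless it is full, a second nonzero rank lies at a coarser level and
   contradicts closedness. *)
have [k rk_gt0 k_max] :=
  @arg_maxnP _ k1 (fun i => 0 < r i)%N (@nat_of_ord _) rk1_gt0.
have r_eq0 (i : 'I_L.+1) : (k < i)%N -> r i = 0%N.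
  move=> lt_ki; apply/eqP; rewrite -leqn0 leqNgt; apply/negP => /k_max le_ik.
  by have := leq_ltn_trans le_ik lt_ki; rewrite ltnn.
have [rk|rk_neq] := eqVneq (r k) (b ^ k)%N; first by left; exists k.
right; exists k => i i_neqk; apply/eqP; rewrite -leqn0 leqNgt; apply/negP.
move=> ri_gt0.
have lt_ik : (i < k)%N.
  rewrite ltn_neqAle (k_max _ ri_gt0 : i <= k)%N andbT.
  by apply/eqP => ik; apply: i_neqk; exact: val_inj.
apply: (@MS_TT_not_closed R b L 0 (fun k => [tuple r k]) k i) => //.
- by move=> j; have [rj|rj] := posnP (r j); [left|right] => l;
    rewrite (tnth_nth 0%N); case: l => -[].
- by move=> j /r_eq0 rj l; rewrite (tnth_nth 0%N); case: l => -[].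
- by apply/andP; split=> //; rewrite ltn_neqAle rk_neq r_le.
Qed.
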